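(* Let $m\ge1$, $1\le l\le k$, $t\ge1$, $r\ge0$ be integers, $n:=k+r$, and let $f:\mathbb{F}_{2^m}^k\to\mathbb{F}_{2^m}^l$ be a linear function of rank $l$. Identify $\mathbb{F}_{2^m}^n$ with $\mathbb{F}_2^{mn}$ by applying a fixed $\mathbb{F}_2$-linear isomorphism $\mathbb{F}_{2^m}\cong\mathbb{F}_2^m$ coordinatewise. Then the adjacency matrix $\mathbf{G}$ of the graph $\mathcal{G}_f(t,k,r)$, with rows and columns indexed by $\mathbb{F}_2^{mn}$ in lexicographic order, is a $2^{mn}\times2^{mn}$ matrix that has the columns of $\mathbf{H}_{2^{mn}}$ as its eigenvectors.
   Context: Write $q=2^m$; $d_H$ is Hamming distance over $\mathbb{F}_q$. $\mathcal{G}_f(t,k,r)$ is the simple graph with vertex set $\mathbb{F}_q^k\times\mathbb{F}_q^r$ in which two distinct vertices $\mathbf{v}_i=(\mathbf{u}_i,\mathbf{r}_i)$, $\mathbf{v}_j=(\mathbf{u}_j,\mathbf{r}_j)$ are adjacent iff either $\mathbf{u}_i=\mathbf{u}_j$, or $f(\mathbf{u}_i)\neq f(\mathbf{u}_j)$ and $d_H(\mathbf{v}_i,\mathbf{v}_j)<2t+1$. The Hadamard matrices are $\mathbf{H}_2=\begin{bmatrix}1&1\\1&-1\end{bmatrix}$ and $\mathbf{H}_{2^N}=\mathbf{H}_2^{\otimes N}$ ($N$-fold Kronecker power). *)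

(* Defs.v *)
From HB Require Import structures.
From mathcomp Require Import all_boot all_order all_algebra.
From mathcomp Require Export mxtens.

Set Implicit Arguments.
Unset Strict Implicit.
Unset Printing Implicit Defensive.

Import Order.TTheory GRing.Theory.
Local Open Scope ring_scope.

Section Graph.
Variable F : finFieldType.

Definition hamming_dist n (x y : 'rV[F]_n) : nat :=
  #|[set i | x 0 i != y 0 i]|.

Definition fgraph_adj t k r l (f : 'rV[F]_k -> 'rV[F]_l) :
    rel ('rV[F]_k * 'rV[F]_r) :=
  fun v w => (v != w) &&
    ((v.1 == w.1) ||
     (f v.1 != f w.1) &&
     (hamming_dist (row_mx v.1 v.2) (row_mx w.1 w.2) < 2 * t + 1)%N).

(* An element a of 'F_2 acts on F as multiplication by the image of its
   representative 0 or 1. This is the 'F_2-vector space structure of F when F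
   has characteristic 2. *)
Definition F2_linear m (phi : F -> 'rV['F_2]_m) : Prop :=
  forall (a : 'F_2) (x y : F),
    phi ((a : nat)%:R * x + y) = a *: phi x + phi y.

End Graph.

Lemma card_bits N : (2 ^ N)%N = #|{: N.-tuplelexi bool}|.
Proof. by rewrite card_tuple card_bool. Qed.

(* The i-th vector of 'F_2^N in lexicographic order, the first coordinate being
   the most significant one and 0 < 1 (as false < true in bool). *)
Definition lex_row N (i : 'I_(2 ^ N)) : 'rV['F_2]_N :=
  let b : N.-tuplelexi bool := Order.enum_val (cast_ord (card_bits N) i) in
  \row_j (tnth b j : nat)%:R.

(* The point of F^k * F^r identified with w, where psi : 'F_2^m -> F is the
   inverse of the chosen isomorphism: the i-th coordinate of the concatenated
   vector is read off the i-th block of m bits of w, since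
   mxtens_index (i, j) = i * m + j. *)
Definition vertex_of_bits (F : finFieldType) m k r
    (psi : 'rV['F_2]_m -> F) (w : 'rV['F_2]_((k + r) * m)) :
    'rV[F]_k * 'rV[F]_r :=
  let v : 'rV[F]_(k + r) :=
    \row_i psi (\row_j w 0 (mxtens_index (i, j))) in
  (lsubmx v, rsubmx v).

Definition adjacency_matrix (R : pzRingType) (V : eqType) (e : rel V)
    N (v : 'I_N -> V) : 'M[R]_N :=
  \matrix_(i, j) (e (v i) (v j) : nat)%:R.

Definition fgraph_matrix (R : pzRingType) (F : finFieldType) m t k r l
    (f : 'rV[F]_k -> 'rV[F]_l) (psi : 'rV['F_2]_m -> F) :
    'M[R]_(2 ^ ((k + r) * m)) :=
  adjacency_matrix R (@fgraph_adj F t k r l f)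
    (fun i => @vertex_of_bits F m k r psi (lex_row i)).

Definition hadamard2 (R : pzRingType) : 'M[R]_2 :=
  \matrix_(i < 2, j < 2) (if (i == 1) && (j == 1) then -1 else 1).

Definition hadamard (R : pzRingType) N : 'M[R]_(2 ^ N) :=
  ntensmx (hadamard2 R) N.

Definition is_eigenvector (R : fieldType) N (A : 'M[R]_N) (x : 'cV[R]_N) :
    Prop :=
  x != 0 /\ exists a : R, A *m x = a *: x.

(* Main.v *)
Require Import Defs.
From HB Require Import structures.
From mathcomp Require Import all_boot all_order all_algebra.

Set Implicit Arguments.
Unset Strict Implicit.
Unset Printing Implicit Defensive.

Import Order.TTheory GRing.Theory Num.Theory.
Local Open Scope ring_scope.

(* Adjacency is invariant under simultaneous translation of both vertices, so
   the adjacency matrix acts as a convolution operator on F_2^(mn). In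
   lexicographic order the (i, j) entry of the Sylvester-Hadamard matrix is
   (-1)^<u_i, u_j>, with u_i the i-th vector, so that its columns are the
   characters of F_2^(mn); and characters diagonalize convolutions. *)

(** Most significant digit first, so that lexicographic order on digits is numerical order. For
    [i < 2 ^ N'.+1] the test [2 ^ N' <= i] is the quotient of [i] by [2 ^ N']. *)
Fixpoint binary_digits N i : seq bool :=
  if N is N'.+1 then (2 ^ N' <= i)%N :: binary_digits N' (i %% 2 ^ N')%N
  else [::].

Lemma size_binary_digits N i : size (binary_digits N i) == N.
Proof. by elim: N i => //= N IHN i; rewrite eqSS IHN. Qed.

Canonical binary_digits_tuple N i : N.-tuple bool :=
  Tuple (size_binary_digits N i).

Lemma divn_expn2 N i : (i < 2 ^ N.+1)%N -> (i %/ 2 ^ N)%N = (2 ^ N <= i)%N.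
Proof.
move=> ltiN.
have lt2 : (i %/ 2 ^ N < 2)%N by rewrite ltn_divLR ?expn_gt0 -?expnS.
have : (0 < i %/ 2 ^ N)%N = (2 ^ N <= i)%N by rewrite divn_gt0 ?expn_gt0.
by case: (i %/ 2 ^ N)%N lt2 => [|[|]] //= _ <-.
Qed.

Lemma lexi_binary_digits N i j : (i < 2 ^ N)%N -> (j < 2 ^ N)%N ->
  (binary_digits N i <= binary_digits N j :> seqlexi bool)%O = (i <= j)%N.
Proof.
elim: N i j => [|N IHN] i j; first by case: i j => [|[|i]] [|[|j]].
move=> ltiN ltjN.
rewrite /= lexi_cons IHN ?ltn_mod ?expn_gt0 //.
have Ei := divn_eq i (2 ^ N); have Ej := divn_eq j (2 ^ N).
rewrite (divn_expn2 ltiN) in Ei; rewrite (divn_expn2 ltjN) in Ej.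
have modi : (i %% 2 ^ N < 2 ^ N)%N by rewrite ltn_mod expn_gt0.
have modj : (j %% 2 ^ N < 2 ^ N)%N by rewrite ltn_mod expn_gt0.
(* Different leading digits put [2 ^ N] between [i] and [j]; equal ones cancel and leave the
   remainders to compare. *)
case: leqP Ei => [lei|lti] Ei; case: leqP Ej => [lej|ltj] Ej /=.
- by rewrite [in RHS]Ei [in RHS]Ej leq_add2l.
- by rewrite leqNgt (leq_trans ltj lei).
- by rewrite (leq_trans (ltnW lti) lej).
- by rewrite [in RHS]Ei [in RHS]Ej leq_add2l.
Qed.

(** Finite total orders of equal size have only one order isomorphism: both the cast and the rank of
    the digit tuple are monotone, hence they agree. *)
Lemma enum_val_lexi N (i : 'I_(2 ^ N)) :
  Order.enum_val (cast_ord (card_bits N) i) = [tuple of binary_digits N i]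
    :> N.-tuplelexi bool.
Proof.
have total_lexi : total (<=%O : rel (N.-tuplelexi bool)) by apply: le_total.
pose rank (x : 'I_(2 ^ N)) :=
  Order.enum_rank ([tuple of binary_digits N x] : N.-tuplelexi bool).
suff -> : cast_ord (card_bits N) i = rank i by rewrite Order.EnumVal.enum_rankK.
symmetry; apply: (Order.mono_unique (f := rank)) => [|||x y].
- exact: le_total.
- by rewrite !card_ord -card_bits.
- move=> x y; rewrite Order.EnumVal.le_enum_rank //.
  exact: lexi_binary_digits.
- by [].
Qed.

Lemma lex_rowE N (i : 'I_(2 ^ N)) p :
  lex_row i 0 p = (nth false (binary_digits N i) p : nat)%:R.
Proof. by rewrite mxE enum_val_lexi (tnth_nth false). Qed.

Lemma F2_of_bool_inj : injective (fun b : bool => (b : nat)%:R : 'F_2).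
Proof. by do 2!case. Qed.

Lemma lex_row_bij N : bijective (@lex_row N).
Proof.
apply: inj_card_bij => [i j eq_row|]; last first.
  by rewrite card_mx card_ord mul1n card_ord.
apply/(@cast_ord_inj _ _ (card_bits N))/(@Order.EnumVal.enum_val_inj _ _ _).
apply: eq_from_tnth => p; have := congr1 (fun u : 'rV_N => u 0 p) eq_row.
by rewrite !mxE => /F2_of_bool_inj.
Qed.

Definition signF2 (R : pzRingType) (a : 'F_2) : R := (-1) ^+ (a : nat).

Lemma signF2D (R : pzRingType) (a b : 'F_2) :
  signF2 R (a + b) = signF2 R a * signF2 R b.
Proof.
rewrite /signF2; case: a b => [[|[|//]] ?] [[|[|//]] ?] /=.
all: rewrite ?mulr1 ?mul1r //.
by rewrite -exprD -[RHS]signr_odd.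
Qed.

Definition walsh (R : pzRingType) N (u v : 'rV['F_2]_N) : R :=
  signF2 R ((u *m v^T) 0 0).

Lemma walshD (R : pzRingType) N (u1 u2 v : 'rV['F_2]_N) :
  walsh R (u1 + u2) v = walsh R u1 v * walsh R u2 v.
Proof. by rewrite /walsh mulmxDl mxE signF2D. Qed.

(** Block form of the Kronecker product: the leading bits of [i] and [j] select an entry of the
    factor [hadamard2], the remainders an entry inside the block. *)
Lemma hadamardS (R : pzRingType) N (i j : 'I_(2 ^ N.+1)) (i' j' : 'I_(2 ^ N)) :
  i' = (i %% 2 ^ N)%N :> nat -> j' = (j %% 2 ^ N)%N :> nat ->
  hadamard R N.+1 i j =
    (-1) ^+ ((2 ^ N <= i) && (2 ^ N <= j))%N * hadamard R N i' j'.
Proof.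
have top (x : 'I_2) : (x == 1) = (x == 1%N :> nat) by [].
(* [ntensmx] splits off a Kronecker factor only from exponent 2 on, so exponent 1 is checked entry
   by entry. *)
case: N i j i' j' => [|N] i j i' j' Ei Ej.
  rewrite /hadamard ntensmx0 ntensmx1 !ord1 !mxE !top.
  by case: i j {Ei Ej} => [[|[|//]] ?] [[|[|//]] ?]; rewrite /= ?mulr1.
rewrite /hadamard ntensmxSS mxE; congr (_ * _); last first.
  by congr (ntensmx _ _ _ _); apply: val_inj.
rewrite mxE !top /= !divn_expn2 //; by do 2!case: (2 ^ _ <= _)%N.
Qed.

Lemma hadamardE (R : pzRingType) N (i j : 'I_(2 ^ N)) :
  hadamard R N i j = walsh R (lex_row i) (lex_row j).
Proof.
(* The product of signs over bit positions meets both sides: the Kronecker recursion peels off its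
   leading factor, and [signF2] turns the sum in the dot product into it. *)
transitivity (\prod_(p < N)
  (-1) ^+ (nth false (binary_digits N i) p && nth false (binary_digits N j) p)
  : R).
  elim: N i j => [|N IHN] i j.
    by rewrite big_ord0 /hadamard ntensmx0 mxE !ord1.
  have lt_mod x : (x %% 2 ^ N < 2 ^ N)%N by rewrite ltn_mod expn_gt0.
  rewrite (@hadamardS R N i j (Ordinal (lt_mod i)) (Ordinal (lt_mod j))) //.
  by rewrite IHN big_ord_recl.
rewrite /walsh mxE (big_morph _ (@signF2D R) (erefl : signF2 R 0 = 1)).
apply: eq_bigr => p _; rewrite [_^T _ _]mxE !lex_rowE /signF2.
by do 2!case: nth.
Qed.

(** Translating by [w i] carries the row of 0 to row [i] and pulls out the factor [chi (w i)]. The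
    condition at 0 excludes the zero function, which is multiplicative too. *)
Lemma convolution_eigenvector (R : fieldType) (V : finZmodType) N
    (w : 'I_N -> V) (e : rel V) (chi : V -> R) :
    bijective w -> (forall x y z, e (x + z) (y + z) = e x y) ->
    (forall x y, chi (x + y) = chi x * chi y) -> chi 0 != 0 ->
  is_eigenvector (adjacency_matrix R e w) (\col_i chi (w i)).
Proof.
move=> w_bij eD chiD chi0; have [w' wK w'K] := w_bij; split.
  apply: contraNneq chi0 => /matrixP/(_ (w' 0) 0).
  by rewrite !mxE w'K => ->.
(* The eigenvalue is the sum of [chi] over the neighbours of 0. *)
exists (\sum_y (e 0 y : nat)%:R * chi y); apply/colP => i; rewrite !mxE.
under eq_bigr do rewrite !mxE.
rewrite -(reindex w (P := predT)
            (F := fun y => (e (w i) y : nat)%:R * chi y)); last exact: onW_bij.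
rewrite (reindex_inj (addIr (w i))) /= mulr_suml; apply: eq_bigr => y _.
by rewrite -{1}[w i]add0r eD chiD mulrA.
Qed.

Section Vertices.
Variables (F : finFieldType) (m k r : nat).

Lemma F2_linear_invD (phi : F -> 'rV['F_2]_m) (psi : 'rV['F_2]_m -> F) :
  F2_linear phi -> cancel phi psi -> cancel psi phi ->
  {morph psi : u v / u + v}.
Proof.
move=> phi_lin phiK psiK u v; apply: (can_inj phiK).
by have := phi_lin 1 (psi u) (psi v); rewrite mul1r scale1r !psiK.
Qed.

Lemma vertex_of_bitsD (psi : 'rV['F_2]_m -> F) :
    {morph psi : u v / u + v} ->
  {morph @vertex_of_bits F m k r psi : u v / u + v}.
Proof.
move=> psiD u v; rewrite /vertex_of_bits.
have -> : \row_i psi (\row_j (u + v) 0 (mxtens_index (i, j))) =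
    \row_i psi (\row_j u 0 (mxtens_index (i, j))) +
    \row_i psi (\row_j v 0 (mxtens_index (i, j))) :> 'rV[F]_(k + r).
  apply/rowP => i; rewrite !mxE -psiD; congr psi.
  by apply/rowP => j; rewrite !mxE.
by rewrite !raddfD.
Qed.

Lemma hamming_distDr n (x y z : 'rV[F]_n) :
  hamming_dist (x + z) (y + z) = hamming_dist x y.
Proof.
apply: eq_card => i.
by rewrite !inE !mxE (inj_eq (addIr _)).
Qed.

(** By linearity [f] sends a common translation to a common translation, so it cancels in every
    comparison. *)
Lemma fgraph_adjD t l (f : 'Hom('rV[F]_k, 'rV[F]_l)) x y z :
  @fgraph_adj F t k r l f (x + z) (y + z) = @fgraph_adj F t k r l f x y.
Proof.
rewrite /fgraph_adj /= (inj_eq (addIr _)) (inj_eq (addIr z.1)) !linearD.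
by rewrite (inj_eq (addIr (f z.1))) -!add_row_mx hamming_distDr.
Qed.

End Vertices.

Theorem corollary7 (R : numFieldType) (F : finFieldType) (m k l r t : nat)
  (hm : (1 <= m)%N) (hl : (1 <= l)%N) (hlk : (l <= k)%N) (ht : (1 <= t)%N)
  (hF : #|F| = (2 ^ m)%N)
  (f : 'Hom('rV[F]_k, 'rV[F]_l)) (hf : \dim (limg f) = l)
  (phi : F -> 'rV['F_2]_m) (psi : 'rV['F_2]_m -> F)
  (hphi : F2_linear phi) (phiK : cancel phi psi) (psiK : cancel psi phi)
  (j : 'I_(2 ^ ((k + r) * m))) :
  is_eigenvector (fgraph_matrix R t r f psi) (col j (hadamard R ((k + r) * m))).
Proof.
have psiD := F2_linear_invD hphi phiK psiK.
(* Adjacency pulled back to bit vectors, where the translations act and [lex_row] enumerates the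
   vertices. *)
pose e x y := @fgraph_adj F t k r l f (@vertex_of_bits F m k r psi x)
                                       (@vertex_of_bits F m k r psi y).
have -> : fgraph_matrix R t r f psi = adjacency_matrix R e (@lex_row _).
  by apply/matrixP => a b; rewrite !mxE.
have -> : col j (hadamard R ((k + r) * m)) =
    \col_i walsh R (lex_row i) (lex_row j).
  by apply/colP => i; rewrite !mxE hadamardE.
apply: (convolution_eigenvector (e := e) (chi := fun u => walsh R u (lex_row j))
  (lex_row_bij _)) => [x y z|x y|].
- by rewrite /e !(vertex_of_bitsD psiD) fgraph_adjD.
- exact: walshD.
- by rewrite /walsh mul0mx mxE oner_eq0.
Qed.
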